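(* Let $k$ be an infinite field of characteristic $0$ with $\mathrm{Aut}\,k=\{\mathrm{id}_k\}$. Then every automorphism of the category $\Theta^0$ is inner; i.e. the quotient group $\mathfrak{A}/\mathfrak{Y}$ is trivial, where $\mathfrak{A}$ is the group of all automorphisms of $\Theta^0$ and $\mathfrak{Y}$ its normal subgroup of inner automorphisms.
   Context: A Lie algebra with projection-derivation over $k$ is a Lie algebra $M$ over $k$ together with a linear map $p:M\to M$ satisfying $p(p(m))=p(m)$ and $p[m_1,m_2]=[p(m_1),m_2]+[m_1,p(m_2)]$ for all $m,m_1,m_2\in M$; homomorphisms are Lie algebra homomorphisms commuting with $p$. $\Theta$ is the variety of all such algebras. Fix a countably infinite set $M^0$; $\Theta^0$ is the category whose objects are the free algebras $F(M)$ of $\Theta$ on finite sets $M\subset M^0$ and whose morphisms are all homomorphisms between them. An automorphism $\Upsilon$ of a category is inner if it is isomorphic as a functor to the identity functor, i.e. there are isomorphisms $s_A:A\to\Upsilon(A)$ with $\Upsilon(\alpha)s_A=s_B\alpha$ for every morphism $\alpha:A\to B$. *)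

(* Defs.v *)
From HB Require Import structures.
From mathcomp Require Import all_boot all_order all_algebra.
From mathcomp Require Export finmap.
Set Implicit Arguments. Unset Strict Implicit. Unset Printing Implicit Defensive.
Import GRing.Theory.
Local Open Scope ring_scope.

Record LieP (k : fieldType) := {
  lcar :> lmodType k;
  lbr : lcar -> lcar -> lcar;
  lp : lcar -> lcar;
  lbr_linl : forall (a : k) (x y z : lcar), lbr (a *: x + y) z = a *: lbr x z + lbr y z;
  lbr_linr : forall (a : k) (x y z : lcar), lbr x (a *: y + z) = a *: lbr x y + lbr x z;
  lbr_alt : forall x : lcar, lbr x x = 0;
  lbr_jacobi : forall x y z : lcar,
      lbr x (lbr y z) + lbr y (lbr z x) + lbr z (lbr x y) = 0;
  lp_lin : forall (a : k) (x y : lcar), lp (a *: x + y) = a *: lp x + lp y;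
  lp_idem : forall x : lcar, lp (lp x) = lp x;
  lp_der : forall x y : lcar, lp (lbr x y) = lbr (lp x) y + lbr x (lp y)
}.

Definition is_hom (k : fieldType) (A B : LieP k) (h : A -> B) : Prop :=
  (forall (a : k) (x y : A), h (a *: x + y) = a *: h x + h y) /\
  (forall x y : A, h (lbr x y) = lbr (h x) (h y)) /\
  (forall x : A, h (lp x) = lp (h x)).

Definition ThHom (k : fieldType) (A B : LieP k) := {h : A -> B | is_hom h}.

(* M^0 = nat (countably infinite); objects of Theta^0 are finite M ⊂ M^0.
   F M with insertion iota M is a free algebra of Theta on M. *)
Definition free_family (k : fieldType) (F : {fset nat} -> LieP k)
    (iota : forall M, nat -> F M) : Prop :=
  forall (M : {fset nat}) (B : LieP k) (f : nat -> B),
    exists h : F M -> B,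
      [/\ is_hom h,
          (forall x, x \in M -> h (iota M x) = f x) &
          (forall h' : F M -> B, is_hom h' ->
             (forall x, x \in M -> h' (iota M x) = f x) -> h' =1 h)].

(* An automorphism (Uo, Um) of the category Theta^0 whose objects are the
   F M and whose morphisms are all homomorphisms; morphisms are compared
   as functions (extensionally). *)
Definition cat_automorphism (k : fieldType) (F : {fset nat} -> LieP k)
    (Uo : {fset nat} -> {fset nat})
    (Um : forall M N, ThHom (F M) (F N) -> ThHom (F (Uo M)) (F (Uo N))) : Prop :=
  [/\ bijective Uo,
      (forall M N (f g : ThHom (F M) (F N)), sval f =1 sval g ->
          sval (Um M N f) =1 sval (Um M N g)),
      (forall M (i : ThHom (F M) (F M)), sval i =1 id -> sval (Um M M i) =1 id),
      (forall M N P (f : ThHom (F M) (F N)) (g : ThHom (F N) (F P)) (h : ThHom (F M) (F P)),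
          sval h =1 sval g \o sval f ->
          sval (Um M P h) =1 sval (Um N P g) \o sval (Um M N f)) &
      (forall M N,
          (forall f g : ThHom (F M) (F N), sval (Um M N f) =1 sval (Um M N g) ->
               sval f =1 sval g) /\
          (forall g : ThHom (F (Uo M)) (F (Uo N)),
               exists f : ThHom (F M) (F N), sval (Um M N f) =1 sval g))].

Definition inner_automorphism (k : fieldType) (F : {fset nat} -> LieP k)
    (Uo : {fset nat} -> {fset nat})
    (Um : forall M N, ThHom (F M) (F N) -> ThHom (F (Uo M)) (F (Uo N))) : Prop :=
  exists s : forall M, ThHom (F M) (F (Uo M)),
    (forall M, exists t : ThHom (F (Uo M)) (F M),
        sval t \o sval (s M) =1 id /\ sval (s M) \o sval t =1 id) /\
    (forall M N (alpha : ThHom (F M) (F N)),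
        sval (Um M N alpha) \o sval (s M) =1 sval (s N) \o sval alpha).

(* Main.v *)
(* An algebra of Theta is a Lie algebra lq A acting on an abelian ideal lp A, where lq = id - p;
   so the free algebra on one generator x is k.(lq x) (+) k[t].(lp x), t = ad (lq x).
   Hence its invertible endomorphisms x |-> a.(lq x) + b.(lp x) commute, which fails on two or
   more generators: an automorphism U of the category preserves F(1) up to isomorphism.
   Elements of A being homomorphisms F(1) -> A, this gives natural bijections s : A -> U(A), and
   the operations of U(A) pulled back along s are words in the operations of A.  First
   s(2a) = 2 s(a); comparing eigenvalues of the dilation x |-> 2x, the new addition is linear,
   hence equal to the old one, the new projection and scalars are combinations of lq x and lp x,
   and the new bracket is bilinear.  The derivation law and the Jacobi identity then force the
   projection to be p and the bracket to be c.[ , ] with c != 0, while the scalars are twisted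
   by an automorphism of k, so by the identity; finally s is corrected by the homothety c^-1. *)
Require Import Defs.
From HB Require Import structures.
From mathcomp Require Import all_boot all_order all_algebra finmap.
From mathcomp Require Import boolp.
Set Implicit Arguments. Unset Strict Implicit. Unset Printing Implicit Defensive.
Import GRing.Theory.
Local Open Scope ring_scope.

(** * Bilinearity, and the splitting of an algebra into the kernel and the image of [lp] *)

Section Basics.
Variables (k : fieldType) (A : LieP k).
Implicit Types (a : k) (x y z : A).

Lemma lbrDl x y z : lbr (x + y) z = lbr x z + lbr y z.
Proof. by have := lbr_linl 1 x y z; rewrite !scale1r. Qed.

Lemma lbrDr x y z : lbr x (y + z) = lbr x y + lbr x z.
Proof. by have := lbr_linr 1 x y z; rewrite !scale1r. Qed.

Lemma lpD x y : lp (x + y) = lp x + lp y.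
Proof. by have := lp_lin 1 x y; rewrite !scale1r. Qed.

Lemma lbr0l x : lbr 0 x = 0.
Proof. by apply: (addIr (lbr 0 x)); rewrite -lbrDl !add0r. Qed.

Lemma lbr0r x : lbr x 0 = 0.
Proof. by apply: (addIr (lbr x 0)); rewrite -lbrDr !add0r. Qed.

Lemma lp0 : lp (0 : A) = 0.
Proof. by apply: (addIr (lp 0)); rewrite -lpD !add0r. Qed.

Lemma lbrZl a x y : lbr (a *: x) y = a *: lbr x y.
Proof. by rewrite -[a *: x]addr0 lbr_linl lbr0l addr0. Qed.

Lemma lbrZr a x y : lbr x (a *: y) = a *: lbr x y.
Proof. by rewrite -[a *: y]addr0 lbr_linr lbr0r addr0. Qed.

Lemma lpZ a x : lp (a *: x) = a *: lp x.
Proof. by rewrite -[a *: x]addr0 lp_lin lp0 addr0. Qed.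

Lemma lbrNr x y : lbr x (- y) = - lbr x y.
Proof. by rewrite -!scaleN1r lbrZr. Qed.

Lemma lpN x : lp (- x) = - lp x.
Proof. by rewrite -!scaleN1r lpZ. Qed.

Lemma lbrC x y : lbr x y = - lbr y x.
Proof.
apply/eqP; rewrite -addr_eq0; have := lbr_alt (x + y).
by rewrite !(lbrDl, lbrDr) !lbr_alt add0r addr0 => ->.
Qed.

Lemma lbr_suml I (r : seq I) (f : I -> A) y :
  lbr (\sum_(i <- r) f i) y = \sum_(i <- r) lbr (f i) y.
Proof. by elim/big_rec2: _ => [|i u v _ <-]; rewrite (lbr0l, lbrDl). Qed.

Lemma lbr_sumr I (r : seq I) (f : I -> A) x :
  lbr x (\sum_(i <- r) f i) = \sum_(i <- r) lbr x (f i).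
Proof. by elim/big_rec2: _ => [|i u v _ <-]; rewrite (lbr0r, lbrDr). Qed.

Lemma lp_sum I (r : seq I) (f : I -> A) :
  lp (\sum_(i <- r) f i) = \sum_(i <- r) lp (f i).
Proof. by elim/big_rec2: _ => [|i u v _ <-]; rewrite (lp0, lpD). Qed.

Definition lq x := x - lp x.

Lemma lqpE x : lq x + lp x = x.
Proof. exact: subrK. Qed.

Lemma lp_lq x : lp (lq x) = 0.
Proof. by rewrite lpD lpN lp_idem subrr. Qed.

Lemma lq_lp x : lq (lp x) = 0.
Proof. by rewrite /lq lp_idem subrr. Qed.

Lemma lq_idem x : lq (lq x) = lq x.
Proof. by rewrite {1}/lq lp_lq subr0. Qed.

Lemma lqD x y : lq (x + y) = lq x + lq y.
Proof. by rewrite /lq lpD opprD addrACA. Qed.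

Lemma lqZ a x : lq (a *: x) = a *: lq x.
Proof. by rewrite /lq lpZ scalerBr. Qed.

Lemma lp_br_qq x y : lp (lbr (lq x) (lq y)) = 0.
Proof. by rewrite lp_der !lp_lq lbr0l lbr0r addr0. Qed.

Lemma lp_br_qp x y : lp (lbr (lq x) (lp y)) = lbr (lq x) (lp y).
Proof. by rewrite lp_der lp_lq lp_idem lbr0l add0r. Qed.

Lemma lp_br_pq x y : lp (lbr (lp x) (lq y)) = lbr (lp x) (lq y).
Proof. by rewrite lp_der lp_lq lp_idem lbr0r addr0. Qed.

(* The bracket of two p-fixed elements has eigenvalue 2, while p only admits 0 and 1. *)
Lemma lbr_pp x y : 2 != 0 :> k -> lbr (lp x) (lp y) = 0.
Proof.
move=> k2; have Ep : lp (lbr (lp x) (lp y)) = 2 *: lbr (lp x) (lp y).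
  by rewrite lp_der !lp_idem scaler_nat mulr2n.
have := lp_idem (lbr (lp x) (lp y)); rewrite {1}Ep lpZ Ep => /eqP.
rewrite -subr_eq0 scalerA -scalerBl scaler_eq0 => /orP[|/eqP//].
by rewrite -[X in _ - X]mulr1 -mulrBr mulf_eq0 (negPf k2) addrK oner_eq0.
Qed.

End Basics.

(** * Homomorphisms *)

Section Homs.
Variables (k : fieldType) (A B : LieP k) (h : A -> B) (hh : is_hom h).

Lemma homD x y : h (x + y) = h x + h y.
Proof. by have := hh.1 1 x y; rewrite !scale1r. Qed.

Lemma hom0 : h 0 = 0.
Proof. by apply: (addIr (h 0)); rewrite -homD !add0r. Qed.

Lemma homZ a x : h (a *: x) = a *: h x.
Proof. by rewrite -[a *: x]addr0 hh.1 hom0 addr0. Qed.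

Lemma homN x : h (- x) = - h x.
Proof. by rewrite -!scaleN1r homZ. Qed.

Lemma hom_br x y : h (lbr x y) = lbr (h x) (h y).
Proof. exact: hh.2.1. Qed.

Lemma hom_p x : h (lp x) = lp (h x).
Proof. exact: hh.2.2. Qed.

Lemma hom_q x : h (lq x) = lq (h x).
Proof. by rewrite homD homN hom_p. Qed.

Lemma hom_sum I (r : seq I) (f : I -> A) :
  h (\sum_(i <- r) f i) = \sum_(i <- r) h (f i).
Proof. by elim/big_rec2: _ => [|i u v _ <-]; rewrite (hom0, homD). Qed.

End Homs.

Lemma hom_id (k : fieldType) (A : LieP k) : is_hom (@id A).
Proof. by []. Qed.

Lemma hom_comp (k : fieldType) (A B C : LieP k) (g : B -> C) (f : A -> B) :
  is_hom g -> is_hom f -> is_hom (g \o f).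
Proof.
move=> hg hf; split=> [a x y|] /=; first by rewrite hf.1 hg.1.
by split=> [x y|x] /=; rewrite ?(hom_br hf) ?(hom_br hg) ?(hom_p hf) ?(hom_p hg).
Qed.

Lemma hom_zero (k : fieldType) (A B : LieP k) : is_hom (fun _ : A => 0 : B).
Proof.
by split=> [a x y|]; [rewrite scaler0 addr0 | split=> *; rewrite ?lbr0l ?lp0].
Qed.

(** * Subalgebras cut out by closed predicates *)

Section Subalgebra.
Variables (k : fieldType) (A : LieP k) (P : A -> Prop).
Hypotheses (P0 : P 0) (PL : forall a x y, P x -> P y -> P (a *: x + y))
  (Pbr : forall x y, P x -> P y -> P (lbr x y)) (Pp : forall x, P x -> P (lp x)).

(** A classical boolean version of [P], so that the subtype inherits the module structure. *)
Definition sub_pred : {pred A} := fun x => `[< P x >].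

Fact sub_pred_submod : GRing.subsemimod_closed sub_pred.
Proof.
split; first split.
- exact/asboolP.
- move=> x y /asboolP Px /asboolP Py; apply/asboolP.
  by rewrite -[x]scale1r; apply: PL.
- move=> a x /asboolP Px; apply/asboolP.
  by rewrite -[_ *: _]addr0; apply: PL.
Qed.

HB.instance Definition _ := GRing.isSubSemiModClosed.Build k A sub_pred sub_pred_submod.

Record sub_car := SubCar { sub_val : A; sub_valP : sub_val \in sub_pred }.
HB.instance Definition _ := [isSub for sub_val].
HB.instance Definition _ := [Choice of sub_car by <:].
HB.instance Definition _ := [SubChoice_isSubLmodule of sub_car by <:].

Lemma sub_br_subproof (x y : sub_car) : lbr (val x) (val y) \in sub_pred.
Proof. by apply/asboolP/Pbr; apply/asboolP/sub_valP. Qed.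
Lemma sub_p_subproof (x : sub_car) : lp (val x) \in sub_pred.
Proof. by apply/asboolP/Pp; apply/asboolP/sub_valP. Qed.

Definition subLieP : LieP k.
Proof.
refine (@Build_LieP k (sub_car : lmodType k) (fun x y => SubCar (sub_br_subproof x y))
  (fun x => SubCar (sub_p_subproof x)) _ _ _ _ _ _ _).
all: move=> *; apply: val_inj; rewrite ?[LHS]/= ?[RHS]/=.
- exact: lbr_linl.
- exact: lbr_linr.
- exact: lbr_alt.
- exact: lbr_jacobi.
- exact: lp_lin.
- exact: lp_idem.
- exact: lp_der.
Defined.

Lemma sub_val_hom : is_hom (val : subLieP -> A).
Proof. by []. Qed.

End Subalgebra.

(** Jacobi for commutators: [a], ..., [f] are the six ordered products of three factors, each
    occurring once with either sign. *)
Lemma six_term_cancel (V : zmodType) (a b c d e f : V) :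
  (a - b - (c - d)) + (c - e - (f - b)) + (f - d - (a - e)) = 0.
Proof.
rewrite !opprB !addrA.
rewrite [LHS](ACl ((1*12)*(2*7)*(3*10)*(4*5)*(6*11)*(8*9))%AC) /=.
by rewrite !subrr !addNr !addr0.
Qed.

(** * Concrete algebras used to test whether words vanish *)

Section Models.
Variable k : fieldType.

(* The semidirect product of R, viewed as a Lie algebra, with its left regular module. *)
Definition regLieP (R : algType k) : LieP k.
Proof.
refine (@Build_LieP k (R * R)%type
  (fun x y => (x.1 * y.1 - y.1 * x.1, x.1 * y.2 - y.1 * x.2))
  (fun x => (0, x.2)) _ _ _ _ _ _ _) => [a [x1 x2] [y1 y2] [z1 z2]
  |a [x1 x2] [y1 y2] [z1 z2]|[x1 x2]|[x1 x2] [y1 y2] [z1 z2]|a [x1 x2] [y1 y2]|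
  [x1 x2]|[x1 x2] [y1 y2]]; congr pair => //=.
- by rewrite mulrDl mulrDr -scalerAl -scalerAr opprD addrACA scalerBr.
- by rewrite mulrDl mulrDr -scalerAl -scalerAr opprD addrACA scalerBr.
- by rewrite mulrDl mulrDr -scalerAl -scalerAr opprD addrACA scalerBr.
- by rewrite mulrDl mulrDr -scalerAl -scalerAr opprD addrACA scalerBr.
- by rewrite subrr.
- by rewrite subrr.
- by rewrite !mulrBr !mulrBl !mulrA six_term_cancel.
- by rewrite !mulrBr !mulrBl !mulrA six_term_cancel.
- by rewrite scaler0 addr0.
- by rewrite !mul0r !mulr0 subrr addr0.
- by rewrite !mul0r subr0 sub0r addrC.
Defined.

(** The two lines with zero bracket: at [1] the word a.(lq x) + b.(lp x) takes the value b for
    [e = true] and a for [e = false]. *)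
Definition abLieP (e : bool) : LieP k.
Proof.
refine (@Build_LieP k k^o (fun x y => 0) (fun x => if e then x else 0) _ _ _ _ _ _ _).
all: move=> *; case: e; by rewrite ?scaler0 ?addr0.
Defined.

End Models.

(** * Independence of eigenvectors *)

Section Eigen.
Variables (k : fieldType) (V : lmodType k) (D : V -> V).
Hypothesis DL : forall a x y, D (a *: x + y) = a *: D x + D y.

Lemma eigen_sum_eq0 (c : nat -> k) (e : nat -> V) N :
  injective c -> (forall i, D (e i) = c i *: e i) ->
  \sum_(i < N) e i = 0 -> forall i, (i < N)%N -> e i = 0.
Proof.
have D0 : D 0 = 0 by have := DL (-1) 0 0; rewrite addr0 scaler0 scaleN1r addNr.
move=> cI; elim: N e => [//|N IH] e De; rewrite big_ord_recr /= => S0 i.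
have eN0 j : (j < N)%N -> e j = 0.
  (* Applying [D - c N] kills the last term and multiplies each other one by the nonzero factor
     [c j - c N]. *)
  move=> jN; apply/eqP; have : (c j - c N) *: e j = 0.
    apply: (IH (fun j => (c j - c N) *: e j)) => // [m|].
      by rewrite -[_ *: e m]addr0 DL D0 addr0 De !scalerA mulrC addr0.
    have DS (n : nat) : D (\sum_(i < n) e i) = \sum_(i < n) c i *: e i.
      elim: n => [|n IHn]; first by rewrite !big_ord0.
      by rewrite !big_ord_recr /= -[X in X + _]scale1r DL IHn De scale1r.
    have := DS N.+1; rewrite !big_ord_recr /= S0 D0 => S1.
    transitivity (\sum_(i < N) c i *: e i - c N *: \sum_(i < N) e i).
      by rewrite scaler_sumr -sumrB; apply: eq_bigr => m _; rewrite scalerBl.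
    by move/eqP: S0; rewrite addr_eq0 => /eqP ->; rewrite scalerN opprK -S1.
  move/eqP; rewrite scaler_eq0 subr_eq0 => /orP[/eqP/cI jE|//].
  by rewrite jE ltnn in jN.
rewrite ltnS leq_eqVlt => /orP[/eqP -> |/eN0//].
by rewrite big1 ?add0r in S0 => // j _; apply: eN0.
Qed.

End Eigen.

(** * The grading by degree in the generators, and its recovery from a dilation *)

Section Grading.
Variables (k : fieldType) (A : LieP k) (X : A -> Prop).

(* [homog n] is the homogeneous part of degree n.+1 with respect to X. *)
Inductive homog : nat -> A -> Prop :=
| homog0 n : homog n 0
| homog_gq x : X x -> homog 0 (lq x)
| homog_gp x : X x -> homog 0 (lp x)
| homog_lin n a u v : homog n u -> homog n v -> homog n (a *: u + v)
| homog_br m n u v : homog m u -> homog n v -> homog (m + n).+1 (lbr u v).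

Lemma homogD n u v : homog n u -> homog n v -> homog n (u + v).
Proof. by move=> hu hv; rewrite -[u]scale1r; apply: homog_lin. Qed.

Lemma homog_p n u : homog n u -> homog n (lp u).
Proof.
elim=> {n u} [n|x _|x Xx|n a u v _ IHu _ IHv|m n u v hu IHu hv IHv].
- by rewrite lp0; apply: homog0.
- by rewrite lp_lq; apply: homog0.
- by rewrite lp_idem; apply: homog_gp.
- by rewrite lp_lin; apply: homog_lin.
- by rewrite lp_der; apply: homogD; apply: homog_br.
Qed.

Lemma homog_dilation (D : A -> A) c n u :
    is_hom D -> (forall x, X x -> D x = c *: x) ->
  homog n u -> D u = c ^+ n.+1 *: u.
Proof.
move=> hD DX; elim=> {n u} [n|x Xx|x Xx|n a u v _ IHu _ IHv|m n u v _ IHu _ IHv].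
- by rewrite (hom0 hD) scaler0.
- by rewrite (hom_q hD) DX // lqZ.
- by rewrite (hom_p hD) DX // lpZ.
- by rewrite hD.1 IHu IHv scalerDr !scalerA mulrC.
- by rewrite (hom_br hD) IHu IHv lbrZl lbrZr scalerA -exprD addSn addnS.
Qed.

(** The vanishing beyond [N] lets two decompositions be padded to a common length and added. *)
Definition decomp (u : A) : Prop :=
  exists N (e : nat -> A), [/\ forall i, homog i (e i),
    forall i, (N <= i)%N -> e i = 0 & u = \sum_(i < N) e i].

Lemma decompL a u v : decomp u -> decomp v -> decomp (a *: u + v).
Proof.
have widen N N' (e : nat -> A) : (forall i, (N <= i)%N -> e i = 0) -> (N <= N')%N ->
    \sum_(i < N) e i = \sum_(i < N') e i.
  move=> e0 NN'; rewrite (big_ord_widen N' _ NN') big_mkcond.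
  by apply: eq_bigr => i _; case: ltnP => // /e0.
case=> N [e [he e0 ->]] [N' [f [hf f0 ->]]].
exists (maxn N N'), (fun i => a *: e i + f i); split=> [i|i|].
- exact: homog_lin.
- by rewrite geq_max => /andP[/e0 -> /f0 ->]; rewrite scaler0 addr0.
- rewrite (widen _ _ _ e0 (leq_maxl N N')) (widen _ _ _ f0 (leq_maxr N N')).
  by rewrite big_split scaler_sumr.
Qed.

Lemma decomp_homog n u : homog n u -> decomp u.
Proof.
move=> hu; exists n.+1, (fun i => if i == n then u else 0); split=> [i|i|].
- by case: eqP => [->|_] //; apply: homog0.
- by case: eqP => // ->; rewrite ltnn.
- rewrite big_ord_recr /= eqxx big1 ?add0r // => i _.
  by case: eqP (ltn_ord i) => // ->; rewrite ltnn.
Qed.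

Lemma decomp_sum I (r : seq I) (f : I -> A) :
  (forall i, decomp (f i)) -> decomp (\sum_(i <- r) f i).
Proof.
move=> df; elim/big_rec: _ => [|i u _ du]; first exact: decomp_homog (homog0 0).
by rewrite -[f i]scale1r; apply: decompL.
Qed.

Lemma decomp_br u v : decomp u -> decomp v -> decomp (lbr u v).
Proof.
case=> N [e [he _ ->]] [N' [f [hf _ ->]]]; rewrite lbr_suml; apply: decomp_sum => i.
by rewrite lbr_sumr; apply: decomp_sum => j; apply: decomp_homog (homog_br _ _).
Qed.

Lemma decomp_p u : decomp u -> decomp (lp u).
Proof.
case=> N [e [he _ ->]]; rewrite lp_sum; apply: decomp_sum => i.
exact: decomp_homog (homog_p (he i)).
Qed.

Hypothesis k_char0 : [pchar k] =i pred0.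

(** Characteristic 0 keeps the powers of 2 apart in [k], so that the dilation by 2 separates
    degrees. *)
Lemma expr2_inj : injective (fun i => 2 ^+ i.+1 : k).
Proof.
move=> i j /= /eqP; rewrite -!natrX.
wlog ij : i j / (i <= j)%N => [W|].
  by case: (leqP i j) => [|/ltnW] /W; [apply | move=> H E; rewrite H // eq_sym].
rewrite eq_sym -subr_eq0 -natrB ?leq_exp2l // ((pcharf0P k).1 k_char0).
by rewrite subn_eq0 leq_exp2l // ltnS => ji; apply/eqP; rewrite eqn_leq ij.
Qed.

Lemma decomp_eigen (D : A -> A) u n :
    is_hom D -> (forall x, X x -> D x = 2 *: x) -> decomp u ->
  D u = 2 ^+ n.+1 *: u -> homog n u.
Proof.
move=> hD DX [N [e [he _ ->]]]; rewrite (hom_sum hD) scaler_sumr => /eqP.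
rewrite -subr_eq0 -sumrB => /eqP S0.
have De i := homog_dilation hD DX (he i).
have e0 i : (i < N)%N -> i != n -> e i = 0.
  (* The defects [D (e j) - 2 ^+ n.+1 *: e j] sum to zero and have distinct eigenvalues, so each
     vanishes; this leaves only the component of index [n]. *)
  move=> iN ni; have Dd j : D (D (e j) - 2 ^+ n.+1 *: e j) =
      2 ^+ j.+1 *: (D (e j) - 2 ^+ n.+1 *: e j).
    by rewrite De -scalerBl (homZ hD) De !scalerA mulrC.
  have := @eigen_sum_eq0 k A D hD.1 _ _ N expr2_inj Dd S0 i iN.
  rewrite De -scalerBl => /eqP; rewrite scaler_eq0 subr_eq0.
  by case/orP=> [/eqP/expr2_inj/eqP|/eqP//]; rewrite (negPf ni).
elim/big_rec: _ => [|i v _ hv]; first exact: homog0.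
apply: homogD => //; have [<-//|ni] := eqVneq (i : nat) n.
by rewrite e0 //; apply: homog0.
Qed.

End Grading.

(** * Linear spans, and polynomials in an adjoint map *)

Section Span.
Variables (k : fieldType) (A : LieP k).

Definition lspan (s : seq A) (u : A) : Prop :=
  exists c : nat -> k, u = \sum_(i < size s) c i *: s`_i.

Lemma lspanL s a u v : lspan s u -> lspan s v -> lspan s (a *: u + v).
Proof.
case=> c -> [d ->]; exists (fun i => a * c i + d i).
by rewrite scaler_sumr -big_split; apply: eq_bigr => i _; rewrite scalerDl scalerA.
Qed.

Lemma lspan0 s : lspan s 0.
Proof. by exists (fun => 0); rewrite big1 // => i _; rewrite scale0r. Qed.

Lemma lspanZ s a u : lspan s u -> lspan s (a *: u).
Proof. by move=> su; rewrite -[_ *: _]addr0; apply: lspanL => //; apply: lspan0. Qed.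

Lemma lspanN s u : lspan s u -> lspan s (- u).
Proof. by rewrite -scaleN1r; apply: lspanZ. Qed.

Lemma lspan_mem s u : u \in s -> lspan s u.
Proof.
move=> us; exists (fun i => (i == index u s)%:R).
rewrite -index_mem in us; rewrite (bigD1 (Ordinal us)) //= eqxx scale1r nth_index -?index_mem //.
rewrite big1 ?addr0 // => i /negPf; rewrite -val_eqE /= => ->.
by rewrite scale0r.
Qed.

Lemma lspan_sum s I (r : seq I) (f : I -> A) :
  (forall i, lspan s (f i)) -> lspan s (\sum_(i <- r) f i).
Proof.
move=> sf; elim/big_rec: _ => [|i u _ su]; first exact: lspan0.
by rewrite -[f i]scale1r; apply: lspanL.
Qed.

Lemma lspan_sub s t u : (forall v, v \in s -> v \in t) -> lspan s u -> lspan t u.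
Proof.
move=> st [c ->]; apply: lspan_sum => i; apply/lspanZ/lspan_mem/st.
exact: mem_nth.
Qed.

Lemma lspan_br s s' t u v :
    (forall x y, x \in s -> y \in s' -> lspan t (lbr x y)) ->
  lspan s u -> lspan s' v -> lspan t (lbr u v).
Proof.
move=> tss' [c ->] [d ->]; rewrite lbr_suml; apply: lspan_sum => i.
rewrite lbr_sumr; apply: lspan_sum => j; rewrite lbrZl lbrZr.
by do 2!apply: lspanZ; apply: tss'; apply: mem_nth.
Qed.

(** The element f(ad x) v, that is, the k[t]-module structure in which t acts as ad x. *)
Definition pact (x v : A) (f : {poly k}) : A :=
  \sum_(i < size f) f`_i *: iter i (lbr x) v.

Lemma pact_widen x v (f : {poly k}) N : (size f <= N)%N ->
  pact x v f = \sum_(i < N) f`_i *: iter i (lbr x) v.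
Proof.
move=> fN; rewrite /pact (big_ord_widen N (fun i => f`_i *: iter i (lbr x) v) fN).
rewrite big_mkcond; apply: eq_bigr => i _.
by case: ltnP => // fi; rewrite nth_default // scale0r.
Qed.

Lemma pactL x v a f g : pact x v (a *: f + g) = a *: pact x v f + pact x v g.
Proof.
rewrite (@pact_widen x v f (maxn (size f) (size g)) (leq_maxl _ _)).
rewrite (@pact_widen x v g (maxn (size f) (size g)) (leq_maxr _ _)).
rewrite (@pact_widen x v (a *: f + g) (maxn (size f) (size g))); last first.
  rewrite (leq_trans (size_polyD _ _)) // geq_max leq_maxr andbT.
  exact: leq_trans (size_scale_leq _ _) (leq_maxl _ _).
rewrite scaler_sumr -big_split; apply: eq_bigr => i _ /=.
by rewrite coefD coefZ scalerDl scalerA.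
Qed.

Lemma pact0 x v : pact x v 0 = 0.
Proof. by rewrite /pact size_poly0 big_ord0. Qed.

Lemma pactC x v c : pact x v c%:P = c *: v.
Proof. by rewrite (@pact_widen x v _ 1) ?size_polyC_leq1 // big_ord1 coefC. Qed.

Lemma pactXM x v f : pact x v ('X * f) = lbr x (pact x v f).
Proof.
rewrite (@pact_widen x v _ (size f).+1); last first.
  by rewrite (leq_trans (size_polyMleq _ _)) // size_polyX.
rewrite big_ord_recl coefXM /= scale0r add0r lbr_sumr.
by apply: eq_bigr => i _; rewrite lbrZr coefXM.
Qed.

End Span.

Lemma hom_pact (k : fieldType) (A B : LieP k) (h : A -> B) x v f :
  is_hom h -> h (pact x v f) = pact (h x) (h v) f.
Proof.
move=> hh; rewrite (hom_sum hh); apply: eq_bigr => i _; rewrite (homZ hh).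
by congr (_ *: _); elim: (nat_of_ord i) => //= n <-; rewrite (hom_br hh).
Qed.

Lemma lp_pact (k : fieldType) (A : LieP k) (x v : A) f :
  lp (pact (lq x) (lp v) f) = pact (lq x) (lp v) f.
Proof.
rewrite lp_sum; apply: eq_bigr => i _; rewrite lpZ; congr (_ *: _).
by elim: (nat_of_ord i) => /= [|n IH]; rewrite ?lp_idem // -IH lp_br_qp.
Qed.

Lemma lq_pact (k : fieldType) (A : LieP k) (x v : A) f :
  lq (pact (lq x) (lp v) f) = 0.
Proof. by rewrite /lq lp_pact subrr. Qed.

(** Here ad (g, 0) is multiplication by g on the second summand, so f(ad (g, 0)) is multiplication
    by f(g). *)
Lemma pact_reg (k : fieldType) (g h f : {poly k}) :
  pact ((g, 0) : regLieP {poly k}) (0, h) f = (0, (f \Po g) * h) :> regLieP {poly k}.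
Proof.
have it i : iter i (lbr ((g, 0) : regLieP {poly k})) (0, h) = (0, g ^+ i * h).
  elim: i => [|i /= ->]; first by rewrite expr0 mul1r.
  by rewrite /= mulr0 mul0r subrr mulr0 subr0 mulrA exprS.
rewrite comp_polyE mulr_suml.
apply/eqP; rewrite /pact; elim: (size f) => [|n IH]; first by rewrite !big_ord0.
rewrite !big_ord_recr /= (eqP IH) it -scalerAl.
by apply/eqP; congr pair; rewrite /= scaler0 addr0.
Qed.

(** * Free algebras: induction, grading and words of low degree *)

Section Free.
Variables (k : fieldType) (F : {fset nat} -> LieP k) (iota : forall M, nat -> F M).
Hypotheses (k_char0 : [pchar k] =i pred0) (Ffree : free_family iota).

Lemma two_neq0 : 2 != 0 :> k.
Proof. by rewrite ((pcharf0P k).1 k_char0). Qed.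

Definition ext M (B : LieP k) (f : nat -> B) : F M -> B := sval (cid (@Ffree M B f)).
Arguments ext M {B} f _.

Lemma ext_hom M (B : LieP k) (f : nat -> B) : is_hom (ext M f).
Proof. by rewrite /ext; case: cid => h []. Qed.

Lemma extE M (B : LieP k) (f : nat -> B) i : i \in M -> ext M f (iota M i) = f i.
Proof. by rewrite /ext; case: cid => h [_ + _] /=; apply. Qed.

Lemma hom_free_eq M (B : LieP k) (g h : F M -> B) : is_hom g -> is_hom h ->
  (forall i, i \in M -> g (iota M i) = h (iota M i)) -> g =1 h.
Proof.
move=> hg hh gh; have [l [_ _ lU]] := @Ffree M B (fun i => h (iota M i)).
by move=> u; rewrite (lU g) // (lU h).
Qed.

(* The universal map to the subalgebra cut out by P, followed by the inclusion, is the identity. *)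
Lemma free_ind M (P : F M -> Prop) : P 0 ->
    (forall a x y, P x -> P y -> P (a *: x + y)) ->
    (forall x y, P x -> P y -> P (lbr x y)) -> (forall x, P x -> P (lp x)) ->
  (forall i, i \in M -> P (iota M i)) -> forall u, P u.
Proof.
move=> P0 PL Pbr Pp Pi u; pose S := subLieP P0 PL Pbr Pp.
(* Outside [M] the value 0 is an arbitrary default: the universal property constrains only indices
   in [M]. *)
pose gen i : S := if pselect (i \in M) is left iM
  then SubCar (introT (asboolP _) (Pi i iM)) else 0.
have hv : is_hom (fun z : F M => sub_val (ext M gen z)).
  exact: hom_comp (sub_val_hom P0 PL Pbr Pp) (ext_hom M gen).
rewrite -(hom_free_eq hv (hom_id _) _ u); first exact/asboolP/sub_valP.
by move=> i iM; rewrite extE // /gen; case: pselect.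
Qed.

Definition gens M (u : F M) : Prop := exists2 i, i \in M & u = iota M i.

Lemma free_decomp M (u : F M) : decomp (@gens M) u.
Proof.
elim/free_ind: u => [|a x y|x y|x|i iM].
- exact: decomp_homog (homog0 _ 0).
- exact: decompL.
- exact: decomp_br.
- exact: decomp_p.
- rewrite -(lqpE (iota M i)) -[lq _]scale1r.
  by apply: decompL; apply: decomp_homog; [apply: homog_gq | apply: homog_gp]; exists i.
Qed.

Definition dil M : F M -> F M := ext M (fun i => 2 *: iota M i).

Lemma dilE M i : i \in M -> dil (iota M i) = 2 *: iota M i.
Proof. exact: extE. Qed.

Lemma dil_hom M : is_hom (@dil M).
Proof. exact: ext_hom. Qed.

(** This expresses degree through [dil] and doubling alone, a condition that can be pulled back
    along [s] before [s] is known to be linear. *)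
Lemma free_eigen M (u : F M) n : dil u = 2 ^+ n.+1 *: u -> homog (@gens M) n u.
Proof.
apply: decomp_eigen (free_decomp u) => //; first exact: ext_hom.
by move=> x [i iM ->]; apply: dilE.
Qed.

Definition gens1 M : seq (F M) :=
  [seq lq (iota M i) | i <- M] ++ [seq lp (iota M i) | i <- M].

Lemma homog0_span M (u : F M) : homog (@gens M) 0 u -> lspan (gens1 M) u.
Proof.
suff aux n v : homog (@gens M) n v -> n = 0%N -> lspan (gens1 M) v by move/aux; apply.
elim=> {n v u} [n _|x [i iM ->] _|x [i iM ->] _|n a u v _ IHu _ IHv n0|//].
- exact: lspan0.
- by apply: lspan_mem; rewrite mem_cat; apply/orP; left; apply/mapP; exists i.
- by apply: lspan_mem; rewrite mem_cat; apply/orP; right; apply/mapP; exists i.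
- by apply: lspanL; [apply: IHu | apply: IHv].
Qed.

Lemma homog1_span M (u : F M) : homog (@gens M) 1 u ->
  lspan [seq lbr x y | x <- gens1 M, y <- gens1 M] u.
Proof.
suff aux n v : homog (@gens M) n v -> n = 1%N ->
    lspan [seq lbr x y | x <- gens1 M, y <- gens1 M] v by move/aux; apply.
elim=> {n v u} [n _|//|//|n a u v _ IHu _ IHv n0|m n u v hu _ hv _].
- exact: lspan0.
- by apply: lspanL; [apply: IHu | apply: IHv].
- case=> /eqP; rewrite addn_eq0 => /andP[/eqP m0 /eqP n0]; subst m n.
  apply: lspan_br (homog0_span hu) (homog0_span hv) => x y xs ys.
  by apply: lspan_mem; apply: allpairs_f.
Qed.

(** * Normal forms on one and two generators *)

Definition M1 : {fset nat} := [fset 0%N]%fset.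
Definition M2 : {fset nat} := [fset 0%N; 1%N]%fset.
Definition gx : F M1 := iota M1 0%N.
Definition g0 : F M2 := iota M2 0%N.
Definition g1 : F M2 := iota M2 1%N.
Definition ev1 (A : LieP k) (a : A) : F M1 -> A := ext M1 (fun => a).
Definition ev2 (A : LieP k) (a b : A) : F M2 -> A :=
  ext M2 (fun i => if i == 0%N then a else b).

Lemma M2_case i : i \in M2 -> i = 0%N \/ i = 1%N.
Proof. by rewrite !inE => /orP[] /eqP; [left | right]. Qed.

Lemma ev1_hom (A : LieP k) (a : A) : is_hom (ev1 a).
Proof. exact: ext_hom. Qed.

Lemma ev2_hom (A : LieP k) (a b : A) : is_hom (ev2 a b).
Proof. exact: ext_hom. Qed.

Lemma ev1E (A : LieP k) (a : A) : ev1 a gx = a.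
Proof. by rewrite /ev1 extE // !inE. Qed.

Lemma ev2E0 (A : LieP k) (a b : A) : ev2 a b g0 = a.
Proof. by rewrite /ev2 extE // !inE. Qed.

Lemma ev2E1 (A : LieP k) (a b : A) : ev2 a b g1 = b.
Proof. by rewrite /ev2 extE // !inE. Qed.

Lemma hom_free1_eq (B : LieP k) (g h : F M1 -> B) : is_hom g -> is_hom h ->
  g gx = h gx -> g =1 h.
Proof. by move=> hg hh gh; apply: hom_free_eq => // i; rewrite !inE => /eqP ->. Qed.

Lemma hom_free2_eq (B : LieP k) (g h : F M2 -> B) : is_hom g -> is_hom h ->
  g g0 = h g0 -> g g1 = h g1 -> g =1 h.
Proof.
by move=> hg hh gh0 gh1; apply: hom_free_eq => // i /M2_case[] ->.
Qed.

Lemma free1_form (u : F M1) : exists a f, u = a *: lq gx + pact (lq gx) (lp gx) f.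
Proof.
elim/free_ind: u => [|c x y [a [f ->]] [b [g ->]]|x y [a [f ->]] [b [g ->]]
  |x [a [f ->]]|i]; last first.
- rewrite !inE => /eqP ->; exists 1, 1%:P.
  by rewrite pactC !scale1r lqpE.
- exists 0, f; rewrite lpD lpZ lp_lq scaler0 add0r.
  by rewrite scale0r add0r lp_pact.
(* With q = [lq gx] and P, Q fixed by [lp], [a q + P, b q + Q] = a [q, Q] - b [q, P] since [P, Q] =
   0, and ad q multiplies the polynomial by 'X. *)
- exists 0, (a *: ('X * g) + - b *: ('X * f)); rewrite scale0r add0r.
  rewrite pactL -[_ *: ('X * f)]addr0 pactL pact0 addr0 !pactXM.
  have := lp_pact gx gx f; have := lp_pact gx gx g.
  move: (lq gx) (pact _ _ f) (pact _ _ g) => q P Q EQ EP.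
  rewrite !(lbrDl, lbrDr) !(lbrZl, lbrZr) lbr_alt !scaler0 add0r.
  have -> : lbr P Q = 0 by rewrite -EP -EQ lbr_pp ?two_neq0.
  by rewrite addr0 [lbr P q]lbrC scalerN scaleNr.
- exists (c * a + b), (c *: f + g).
  by rewrite pactL scalerDr scalerA addrACA -scalerDl.
- by exists 0, 0; rewrite scale0r pact0 addr0.
Qed.

Lemma homog0_free1 (u : F M1) : homog (@gens M1) 0 u ->
  exists a b, u = a *: lq gx + b *: lp gx.
Proof.
move/homog0_span/(@lspan_sub _ _ _ [:: lq gx; lp gx]) => H.
case: H => [v|c ->].
  by rewrite mem_cat => /orP[] /mapP[i]; rewrite !inE => /eqP -> ->; rewrite eqxx ?orbT.
by rewrite !big_ord_recl big_ord0 /= addr0; exists (c 0%N), (c 1%N).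
Qed.

Lemma gens1_M2 v : v \in gens1 M2 -> v \in [:: lq g0; lp g0; lq g1; lp g1].
Proof.
by rewrite mem_cat !inE => /orP[] /mapP[i /M2_case[] -> ->]; rewrite eqxx ?orbT.
Qed.

Lemma homog0_free2 (u : F M2) : homog (@gens M2) 0 u ->
  exists c0 d0 c1 d1, u = c0 *: lq g0 + d0 *: lp g0 + (c1 *: lq g1 + d1 *: lp g1).
Proof.
move/homog0_span/lspan_sub => /(_ _ gens1_M2)[c ->].
exists (c 0%N), (c 1%N), (c 2%N), (c 3%N).
by rewrite !big_ord_recl big_ord0 /= addr0 !addrA.
Qed.

(** Up to sign there are six brackets of distinct elements among the four of degree one;
    [lp g0, lp g1] vanishes and five remain. *)
Lemma homog1_free2 (u : F M2) : homog (@gens M2) 1 u ->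
  exists c00 a b c c11, u = c00 *: lbr (lq g0) (lp g0) + c11 *: lbr (lq g1) (lp g1) +
    (a *: lbr (lq g0) (lq g1) + (b *: lbr (lq g0) (lp g1) + c *: lbr (lp g0) (lq g1))).
Proof.
pose t := [:: lbr (lq g0) (lp g0); lbr (lq g1) (lp g1); lbr (lq g0) (lq g1);
  lbr (lq g0) (lp g1); lbr (lp g0) (lq g1)].
move/homog1_span => hu; suff [c ->] : lspan t u.
  exists (c 0%N), (c 2%N), (c 3%N), (c 4%N), (c 1%N).
  by rewrite !big_ord_recl big_ord0 /= addr0 !addrA.
case: hu => c ->; apply: lspan_sum => i; apply: lspanZ.
have /allpairsP[[x y] /= [/gens1_M2 + /gens1_M2 + ->]] := mem_nth 0 (ltn_ord i).
have tN v : - v \in t -> lspan t v.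
  by move=> vt; rewrite -[v]opprK; apply/lspanN/lspan_mem.
rewrite !inE => /or4P[] /eqP -> /or4P[] /eqP ->; rewrite ?lbr_alt ?lbr_pp ?two_neq0 //;
  try exact: lspan0;
  (try by apply: lspan_mem; rewrite !inE eqxx ?orbT);
  by apply: tN; rewrite -lbrC !inE eqxx ?orbT.
Qed.

End Free.
Arguments ext {k F iota} Ffree M {B} f _.

(** * Nonzero test words, and the invertible endomorphisms of F(1) *)

Section FreeOne.
Variables (k : fieldType) (F : {fset nat} -> LieP k) (iota : forall M, nat -> F M).
Hypotheses (k_char0 : [pchar k] =i pred0) (Ffree : free_family iota).
Local Notation ev1 := (ev1 Ffree).
Local Notation ev2 := (ev2 Ffree).
Local Notation gx := (gx iota).
Local Notation g0 := (g0 iota).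
Local Notation g1 := (g1 iota).

Lemma br_gx_neq0 : lbr (lq gx) (lp gx) != 0.
Proof.
apply: contraTneq isT => E.
(* At (1, 1) the two parts are (1, 0) and (0, 1), with bracket (0, 1). *)
have := congr1 (ev1 ((1, 1) : regLieP {poly k})) E; have h := ev1_hom Ffree.
rewrite (hom0 (h _ _)) (hom_br (h _ _)) (hom_q (h _ _)) (hom_p (h _ _)) ev1E.
move/(congr1 snd) => /= /eqP.
by rewrite !subr0 mulr1 mul0r subr0 oner_eq0.
Qed.

Lemma lq_gx_neq0 : lq gx != 0.
Proof. by apply: contraNneq br_gx_neq0 => ->; rewrite lbr0l. Qed.

Lemma lp_gx_neq0 : lp gx != 0.
Proof. by apply: contraNneq br_gx_neq0 => ->; rewrite lbr0r. Qed.

Lemma br_g_neq0 : lbr (lq g0) (lp g1) != 0.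
Proof.
apply: contraNneq br_gx_neq0 => /(congr1 (ev2 gx gx)); have h := ev2_hom Ffree gx gx.
by rewrite (hom0 h) (hom_br h) (hom_q h) (hom_p h) ev2E0 ev2E1 => ->.
Qed.

Lemma br3_neq0 : lbr (lp g1) (lbr (lq g0) (lq g1)) != 0.
Proof.
apply: contraTneq isT => E.
(* A noncommutative model is needed: the word takes the value (0, - (A B - B A)) at these matrix
   units, and A B - B A has entry 1 in the upper left corner. *)
pose A : 'M[k]_2 := delta_mx 0 1; pose B : 'M[k]_2 := delta_mx 1 0.
have h := ev2_hom Ffree ((A, 0) : regLieP 'M[k]_2) (B, 1).
have := congr1 (ev2 ((A, 0) : regLieP 'M[k]_2) (B, 1)) E.
rewrite (hom0 h) !(hom_br h) !(hom_q h) (hom_p h) ev2E0 ev2E1.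
move/(congr1 snd) => /=; rewrite !subr0 mul0r sub0r mulr1 => /eqP.
rewrite oppr_eq0 /A /B -!mulmxE !mul_delta_mx => /eqP /matrixP /(_ 0 0).
by rewrite !mxE /= subr0 => /eqP; rewrite oner_eq0.
Qed.

(* In the model k[X] (+) k[X] the equation reads f'(aX) f = 1, so f is constant. *)
Lemma right_inv_linear u v : ev1 u v = gx -> exists a b, u = a *: lq gx + b *: lp gx.
Proof.
have [a [f uE]] := free1_form k_char0 Ffree u.
have [a' [f' vE]] := free1_form k_char0 Ffree v.
have uq : lq u = a *: lq gx.
  by rewrite uE lqD lqZ lq_idem lq_pact addr0.
have up : lp u = pact (lq gx) (lp gx) f.
  by rewrite uE lpD lpZ lp_lq scaler0 add0r lp_pact.
have hu := ev1_hom Ffree u.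
pose R := regLieP {poly k}; pose h := ev1 (('X, 1) : R).
have hh : is_hom h := ev1_hom Ffree _.
have hq : h (lq gx) = ('X, 0).
  by rewrite (hom_q hh) /h ev1E; congr pair => /=; rewrite ?oppr0 ?addr0 ?subrr.
have hp : h (lp gx) = (0, 1) by rewrite (hom_p hh) /h ev1E.
rewrite {1}vE hu.1 (hom_q hu) (hom_pact _ _ _ hu) (hom_q hu) (hom_p hu) ev1E uq up.
move=> /(congr1 h) /(congr1 snd).
rewrite (homD hh) (homZ hh) (homZ hh) (hom_pact _ _ _ hh) (homZ hh) (hom_pact _ _ _ hh) hq hp.
rewrite /h ev1E pact_reg comp_polyXr mulr1.
have -> : a *: (('X, 0) : R) = (a *: 'X, 0) by congr pair; rewrite /= scaler0.
rewrite pact_reg /= !scaler0 add0r => /(congr1 (fun p : {poly k} => size p)) /eqP.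
rewrite size_poly1 size_mul_eq1 => /andP[_ /eqP/eqP sf].
have /size_poly1P [c _ fE] := sf.
by exists a, c; rewrite uE fE pactC.
Qed.

(** Either composite scales [lq gx] by a a' and [lp gx] by b b'. *)
Lemma linear_comm a b a' b' :
  let u := a *: lq gx + b *: lp gx in let v := a' *: lq gx + b' *: lp gx in
  ev1 u v = ev1 v u.
Proof.
have qE c d : lq (c *: lq gx + d *: lp gx) = c *: lq gx.
  by rewrite lqD !lqZ lq_idem lq_lp scaler0 addr0.
have pE c d : lp (c *: lq gx + d *: lp gx) = d *: lp gx.
  by rewrite lp_lin lpZ lp_idem lp_lq scaler0 add0r.
move=> u v; have hu := ev1_hom Ffree u; have hv := ev1_hom Ffree v.
rewrite {1}/v {2}/u hu.1 (homZ hu) hv.1 (homZ hv) (hom_q hu) (hom_p hu) (hom_q hv) (hom_p hv).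
by rewrite !ev1E !qE !pE !scalerA mulrC [b' * b]mulrC.
Qed.
End FreeOne.

(** * Transport of the operations along natural bijections [s], with [T M] in the role of the image
    of [F M] *)

Section Transport.
Variables (k : fieldType) (F : {fset nat} -> LieP k) (iota : forall M, nat -> F M).
Hypotheses (k_char0 : [pchar k] =i pred0) (Ffree : free_family iota).
Let k2 : 2 != 0 :> k := two_neq0 k_char0.
Local Notation ev1 := (ev1 Ffree).
Local Notation ev2 := (ev2 Ffree).
Local Notation dil := (dil Ffree).
Local Notation gx := (gx iota).
Local Notation g0 := (g0 iota).
Local Notation g1 := (g1 iota).
Variables (T : {fset nat} -> LieP k) (s : forall M, F M -> T M).
Hypotheses (s_inj : forall M, injective (@s M)) (s_surj : forall M t, exists u, @s M u = t).
Hypothesis s_nat : forall M N (h : F M -> F N), is_hom h ->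
  exists2 h' : T M -> T N, is_hom h' & forall u, h' (s u) = s (h u).

(** The counterpart of the zero endomorphism is constant with value [s 0]; being linear, it sends 0
    to 0. *)
Lemma s0 M : s (0 : F M) = 0.
Proof.
have [h hh hs] := s_nat (hom_zero (F M) (F M)).
have [u su] := s_surj (0 : T M).
by rewrite -(hs u) su (hom0 hh).
Qed.

(* The word w with s w = 2 s x is invertible, hence a.(lq x) + b.(lp x); both coefficients are 2
   because a word +' in two variables with 0 +' x = x = x +' 0 is + in any abelian algebra. *)
Lemma s_double M (u : F M) : s (2 *: u) = 2 *: s u.
Proof.
suff H : s (2 *: gx) = 2 *: s gx.
  have [h hh hs] := s_nat (ev1_hom Ffree u); have := hs (2 *: gx).
  by rewrite H (homZ hh) hs (homZ (ev1_hom Ffree u)) ev1E.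
have [w sw] := s_surj (2 *: s gx); have [v sv] := s_surj (2^-1 *: s gx).
(* Halving in [T] undoes doubling, so the word [w] has the one-sided inverse required by
   [right_inv_linear]. *)
have wv : ev1 w v = gx.
  have [h hh hs] := s_nat (ev1_hom Ffree w); apply: s_inj.
  by rewrite -hs sv (homZ hh) hs ev1E sw scalerA mulVf // scale1r.
have [w2 sw2] := s_surj (s g0 + s g1).
have E2 a b : s (ev2 a b w2) = s (a : F M1) + s b.
  have [h hh hs] := s_nat (ev2_hom Ffree a b).
  by rewrite -hs sw2 (homD hh) !hs ev2E0 ev2E1.
have Ew : ev2 gx gx w2 = w by apply: s_inj; rewrite E2 sw scaler_nat mulr2n.
have E0 : ev2 gx 0 w2 = gx by apply: s_inj; rewrite E2 s0 addr0.
have E1 : ev2 0 gx w2 = gx by apply: s_inj; rewrite E2 s0 add0r.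
have abel e : ev1 (1 : abLieP k e) w = 2.
  have hx := ev1_hom Ffree (1 : abLieP k e).
  have H a b : ev1 (1 : abLieP k e) (ev2 a b w2) =
      ev2 (ev1 (1 : abLieP k e) a) (ev1 (1 : abLieP k e) b) w2.
    apply: (hom_free2_eq Ffree (g := ev1 (1 : abLieP k e) \o ev2 a b)).
    - exact: hom_comp hx (ev2_hom _ _ _).
    - exact: ev2_hom.
    - by rewrite /= !ev2E0.
    - by rewrite /= !ev2E1.
  have H0 := H gx 0; have H1 := H 0 gx; rewrite -Ew H.
  rewrite E0 (hom0 hx) ev1E in H0; rewrite E1 (hom0 hx) ev1E in H1.
  (* In an abelian algebra evaluation is additive in the pair of arguments, so [w2] at (1, 1) is its
     value at (1, 0) plus its value at (0, 1), namely 1 + 1. *)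
  have hom2 : is_hom (fun u => ev2 (1 : abLieP k e) 0 u + ev2 (0 : abLieP k e) 1 u).
    split=> [a x y|]; last split=> [x y|x].
    - by rewrite !(ev2_hom Ffree _ _).1 scalerDr addrACA.
    - by rewrite !(hom_br (ev2_hom Ffree _ _)) addr0.
    - by rewrite !(hom_p (ev2_hom Ffree _ _)) lpD.
  rewrite ev1E (hom_free2_eq Ffree (h := fun u => ev2 (1 : abLieP k e) 0 u +
    ev2 (0 : abLieP k e) 1 u)) ?ev2E0 ?ev2E1 ?addr0 ?add0r //; last exact: ev2_hom.
  by rewrite -H0 -H1.
have [a [b wE]] := right_inv_linear k_char0 wv.
have [Et Ef] := (abel true, abel false).
have ht e := ev1_hom Ffree (1 : abLieP k e).
rewrite wE (ht _).1 (homZ (ht _)) (hom_q (ht _)) (hom_p (ht _)) ev1E in Et.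
rewrite wE (ht _).1 (homZ (ht _)) (hom_q (ht _)) (hom_p (ht _)) ev1E in Ef.
have {}Ef : a = 2.
  by rewrite /lq [lp _]/= subr0 scaler0 addr0 in Ef; rewrite -Ef -[RHS]/(a * 1) mulr1.
have {}Et : b = 2.
  by rewrite /lq [lp _]/= subrr scaler0 add0r in Et; rewrite -Et -[RHS]/(b * 1) mulr1.
by rewrite -[X in s (_ *: X)]lqpE scalerDr -{1}Ef -{1}Et -wE sw.
Qed.

(** By [s_double], [s] commutes with multiplication by powers of 2, so an eigenvalue equation in
    [T M] pulls back to one for [dil]. *)
Lemma s_dil M (u : F M) (h : T M -> T M) n : is_hom h ->
  (forall u, h (s u) = s (dil u)) -> h (s u) = 2 ^+ n.+1 *: s u ->
  homog (@gens _ _ iota M) n u.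
Proof.
move=> hh hs Eh; apply: (@free_eigen _ _ _ k_char0 Ffree); apply: s_inj.
rewrite -hs Eh; elim: n.+1 => [|m IH]; first by rewrite !expr0 !scale1r.
by rewrite exprS -!scalerA s_double IH.
Qed.

Lemma s_dil_g (h : T M2 -> T M2) : (forall u, h (s u) = s (dil u)) ->
  h (s g0) = 2 *: s g0 /\ h (s g1) = 2 *: s g1.
Proof. by move=> hs; rewrite !hs !dilE ?s_double // !inE. Qed.

Lemma sD M (a b : F M) : s (a + b) = s a + s b.
Proof.
suff H : s (g0 + g1) = s g0 + s g1.
  have [h hh hs] := s_nat (ev2_hom Ffree a b); have := hs (g0 + g1).
  by rewrite H (homD hh) !hs (homD (ev2_hom Ffree a b)) ev2E0 ev2E1.
move=> {a b M}; have [w sw] := s_surj (s g0 + s g1).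
(* The counterpart of [dil] doubles [s g0 + s g1], so the word [w] has degree one. *)
have [c0 [d0 [c1 [d1 wE]]]] :
    exists c0 d0 c1 d1, w = c0 *: lq g0 + d0 *: lp g0 + (c1 *: lq g1 + d1 *: lp g1).
  apply: homog0_free2; have [h hh hs] := s_nat (dil_hom Ffree M2).
  have [h0 h1] := s_dil_g hs.
  by apply: (s_dil hh hs); rewrite sw (homD hh) h0 h1 scalerDr.
have E2 a b : ev2 a b w = c0 *: lq a + d0 *: lp a + (c1 *: lq b + d1 *: lp b).
  have h := ev2_hom Ffree a b; rewrite wE !(homD h) !(homZ h).
  by rewrite !(hom_q h) !(hom_p h) ev2E0 ev2E1.
have E2s a b : s (ev2 a b w) = s a + s b :> T M2.
  have [h hh hs] := s_nat (ev2_hom Ffree a b).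
  by rewrite -hs sw (homD hh) !hs ev2E0 ev2E1.
have lq0 : lq (0 : F M2) = 0 by rewrite /lq lp0 subr0.
(* Setting either variable to 0 must return the other one, which determines each half of [w]. *)
rewrite -sw wE; congr s; congr (_ + _); apply: s_inj.
- by have := E2s g0 0; rewrite E2 lq0 lp0 !scaler0 !addr0 s0 addr0.
- by have := E2s 0 g1; rewrite E2 lq0 lp0 !scaler0 !add0r s0 add0r.
Qed.

Lemma sN M (a : F M) : s (- a) = - s a.
Proof. by apply/eqP; rewrite -addr_eq0 -sD addNr s0. Qed.

(** Naturality makes the operation evaluation of a single word at the generator, and compatibility
    with doubling puts that word in degree one. It serves for both projection and scalars. *)
Lemma unary_word (phi : forall M, T M -> T M) :
    (forall M N (h : T M -> T N) t, is_hom h -> h (phi M t) = phi N (h t)) ->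
    (forall M t, phi M (2 *: t) = 2 *: phi M t) ->
  exists a b, forall M (u : F M), s (a *: lq u + b *: lp u) = phi M (s u).
Proof.
move=> phin phi2; have [w sw] := s_surj (phi _ (s gx)).
have [a [b wE]] : exists a b, w = a *: lq gx + b *: lp gx.
  apply: homog0_free1; have [h hh hs] := s_nat (dil_hom Ffree M1).
  apply: (s_dil hh hs); rewrite sw phin // hs dilE ?s_double ?phi2 //.
  by rewrite !inE.
exists a, b => M u; have [h hh hs] := s_nat (ev1_hom Ffree u).
rewrite -[u in RHS](ev1E Ffree u) -hs -phin // -sw hs wE.
by rewrite (ev1_hom Ffree u).1 (homZ (ev1_hom Ffree u)) (hom_q (ev1_hom Ffree u))
  (hom_p (ev1_hom Ffree u)) ev1E.
Qed.

(** The word has degree two, hence five coefficients. Setting one argument to 0 removes the terms in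
    a single variable, and [x, x] = 0 equates the two mixed coefficients. *)
Lemma bracket_word : exists a b, forall M (u v : F M),
  s (a *: lbr (lq u) (lq v) + b *: (lbr (lq u) (lp v) + lbr (lp u) (lq v))) =
  lbr (s u) (s v).
Proof.
have [w sw] := s_surj (lbr (s g0) (s g1)).
have E2s M (a b : F M) : s (ev2 a b w) = lbr (s a) (s b).
  have [h hh hs] := s_nat (ev2_hom Ffree a b).
  by rewrite -hs sw (hom_br hh) !hs ev2E0 ev2E1.
have [c0 [a [b [c [c1 wE]]]]] : exists c0 a b c c1,
    w = c0 *: lbr (lq g0) (lp g0) + c1 *: lbr (lq g1) (lp g1) +
    (a *: lbr (lq g0) (lq g1) + (b *: lbr (lq g0) (lp g1) + c *: lbr (lp g0) (lq g1))).
  apply: (homog1_free2 k_char0); have [h hh hs] := s_nat (dil_hom Ffree M2).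
  have [h0 h1] := s_dil_g hs.
  by apply: (s_dil hh hs); rewrite sw (hom_br hh) h0 h1 lbrZl lbrZr scalerA.
have E2 M (u v : F M) : ev2 u v w =
    c0 *: lbr (lq u) (lp u) + c1 *: lbr (lq v) (lp v) +
    (a *: lbr (lq u) (lq v) + (b *: lbr (lq u) (lp v) + c *: lbr (lp u) (lq v))).
  have h := ev2_hom Ffree u v; rewrite wE !(homD h) !(homZ h) !(hom_br h).
  by rewrite !(hom_q h) !(hom_p h) ev2E0 ev2E1.
have lq0 M : lq (0 : F M) = 0 by rewrite /lq lp0 subr0.
have C0 M (u : F M) : c0 *: lbr (lq u) (lp u) = 0.
  apply: s_inj; have := E2s M u 0.
  by rewrite E2 lq0 lp0 !lbr0r !scaler0 !addr0 s0 lbr0r => ->.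
have C1 M (u : F M) : c1 *: lbr (lq u) (lp u) = 0.
  apply: s_inj; have := E2s M 0 u.
  by rewrite E2 lq0 lp0 !lbr0l !scaler0 !addr0 add0r s0 lbr0l => ->.
have bc : b = c.
  have : ev2 gx gx w = 0 by apply: s_inj; rewrite E2s lbr_alt s0.
  rewrite E2 C0 C1 lbr_alt scaler0 !add0r [lbr (lp _) _]lbrC scalerN -scalerBl => /eqP.
  by rewrite scaler_eq0 (negPf (br_gx_neq0 Ffree)) orbF subr_eq0 => /eqP.
by exists a, b => M u v; rewrite -E2s E2 C0 C1 !add0r scalerDr {2}bc.
Qed.

(** * Identification of the transported projection, bracket and scalars *)

Variable e : F M1 -> T M1.
(** While [s] is so far only additive, [e] is an isomorphism and carries the nonvanishing of words
    in [F M1] over to [T M1]. *)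
Hypotheses (e_hom : is_hom e) (e_inj : injective e) (e_surj : forall t, exists u, e u = t).
Hypothesis e_gx : e gx = s gx.

(** The transported projection is a.lq + b.lp. The derivation law forces a = 0, idempotence gives b
    b = b, and b = 0 would make [lp] vanish at [s gx]. *)
Lemma s_lp M (u : F M) : s (lp u) = lp (s u).
Proof.
have [al [be Hbr]] := bracket_word.
have [a [b Hp]] : exists a b, forall M (u : F M), s (a *: lq u + b *: lp u) = lp (s u).
  apply: (unary_word (phi := fun M => @lp k (T M))) => [M' N h t hh|M' t].
    by rewrite (hom_p hh).
  by rewrite lpZ.
have qE M' c d (v : F M') : lq (c *: lq v + d *: lp v) = c *: lq v.
  by rewrite lqD !lqZ lq_idem lq_lp scaler0 addr0.
have pE M' c d (v : F M') : lp (c *: lq v + d *: lp v) = d *: lp v.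
  by rewrite lp_lin lpZ lp_idem lp_lq scaler0 add0r.
have a0 : a = 0.
  apply/eqP; apply: contraTT isT => a_neq0.
  (* The right side of the derivation law exceeds the left by exactly [a] times the word of the
     transported bracket. *)
  have E : a *: (al *: lbr (lq g0) (lq g1) +
      be *: (lbr (lq g0) (lp g1) + lbr (lp g0) (lq g1))) = 0.
    set w := (X in a *: X); have := lp_der (s g0) (s g1).
    rewrite -Hbr -!Hp -!Hbr -sD => /s_inj; rewrite !qE !pE -/w.
    have -> : lq w = al *: lbr (lq g0) (lq g1).
      by rewrite /lq /w lpD !lpZ lp_br_qq lpD lp_br_qp lp_br_pq scaler0 add0r addrK.
    have -> : lp w = be *: (lbr (lq g0) (lp g1) + lbr (lp g0) (lq g1)).
      by rewrite /w lpD !lpZ lp_br_qq lpD lp_br_qp lp_br_pq scaler0 add0r.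
    rewrite /w !(lbrZl, lbrZr) !(scalerDr, scalerA) ![_ * a]mulrC ![_ * b]mulrC.
    set A := (a * al) *: _; set B := (a * be) *: lbr _ (lp _).
    set C := (a * be) *: lbr (lp _) _; set B' := (b * be) *: lbr _ (lp _).
    set C' := (b * be) *: lbr (lp _) _.
    rewrite !addrA [RHS](ACl ((1*5*3)*(4*2*6))%AC) /= => /eqP.
    by rewrite -subr_eq0 opprD addrA subrr sub0r oppr_eq0 => /eqP.
  (* For nonzero [a] the bracket of the two generators would vanish, hence by naturality every
     bracket in [T M1], contradicting [br_gx_neq0] through [e]. *)
  have Z : lbr (s g0) (s g1) = 0.
    by rewrite -Hbr; move/eqP: E; rewrite scaler_eq0 (negPf a_neq0) => /eqP ->; rewrite s0.
  have Zs (u' v' : F M1) : lbr (s u') (s v') = 0.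
    have [h hh hs] := s_nat (ev2_hom Ffree u' v').
    by have := congr1 h Z; rewrite (hom_br hh) !hs ev2E0 ev2E1 (hom0 hh).
  have := br_gx_neq0 Ffree; rewrite -(inj_eq e_inj) (hom_br e_hom) (hom0 e_hom).
  have [u1 <-] := s_surj (e (lq gx)); have [u2 <-] := s_surj (e (lp gx)).
  by rewrite Zs eqxx.
have b01 : b * b = b.
  have := lp_idem (s gx); rewrite -!Hp => /s_inj; rewrite a0 !scale0r !add0r lpZ lp_idem scalerA.
  by move/eqP; rewrite -subr_eq0 -scalerBl scaler_eq0 (negPf (lp_gx_neq0 Ffree)) orbF subr_eq0 => /eqP.
have b1 : b = 1.
  have [b0|b_neq0] := eqVneq b 0; last by apply: (mulfI b_neq0); rewrite mulr1.
  have := lp_gx_neq0 Ffree; rewrite -(inj_eq e_inj) (hom_p e_hom) (hom0 e_hom) e_gx -Hp.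
  by rewrite a0 b0 !scale0r addr0 s0 eqxx.
by rewrite -Hp a0 b1 scale0r scale1r add0r.
Qed.

Lemma s_lq M (u : F M) : s (lq u) = lq (s u).
Proof. by rewrite sD sN s_lp. Qed.

(** In the transported Jacobi identity for [lq g0], [lq g1], [lp g1], the term through
    [lq g0, lq g1] has coefficient be al and the others be be. Subtracting be be times the original
    identity leaves be (al - be) times the nonzero word of [br3_neq0]. *)
Lemma s_br : exists2 c, c != 0 & forall M (u v : F M), s (c *: lbr u v) = lbr (s u) (s v).
Proof.
have [al [be Hbr]] := bracket_word.
have qq M (u v : F M) : lbr (s (lq u)) (s (lq v)) = s (al *: lbr (lq u) (lq v)).
  by rewrite -Hbr !lq_idem !lp_lq lbr0l lbr0r addr0 scaler0 addr0.
have qp M (u v : F M) : lbr (s (lq u)) (s (lp v)) = s (be *: lbr (lq u) (lp v)).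
  by rewrite -Hbr !lq_idem lp_idem lp_lq lq_lp !lbr0r scaler0 add0r addr0.
have be0 : be != 0.
  apply: contraNneq (br_gx_neq0 Ffree) => be0.
  rewrite -(inj_eq e_inj) (hom_br e_hom) (hom_q e_hom) (hom_p e_hom) (hom0 e_hom) e_gx.
  by rewrite -s_lq -s_lp qp be0 scale0r s0.
have albe : al = be.
  (* Being fixed by [lq], this inner bracket can itself be the left argument in [qp]. *)
  have qX : lq (lbr (lq g0) (lq g1)) = lbr (lq g0) (lq g1).
    by rewrite {1}/lq lp_br_qq subr0.
  have J := lbr_jacobi (s (lq g0)) (s (lq g1)) (s (lp g1)).
  have J' := lbr_jacobi (lq g0) (lq g1) (lp g1).
  rewrite [lbr (s (lp g1)) (s (lq g0))]lbrC lbrNr 2!qp qq in J.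
  rewrite -[lbr (lq g1) (lp g1)]lp_br_qp -[lbr (lq g0) (lp g1)]lp_br_qp in J.
  rewrite -qX -!lpZ -lqZ !qp [lbr (s (lp _)) _]lbrC qp in J.
  rewrite lpZ lqZ lpZ !lbrZr lbrZl !scalerA -!sN -!sD -(s0 M2) in J.
  move/s_inj: J; rewrite !lp_br_qp qX => J.
  rewrite [lbr (lp g1) (lq g0)]lbrC lbrNr in J'.
  have E : (be * (al - be)) *: lbr (lp g1) (lbr (lq g0) (lq g1)) = 0.
    rewrite mulrBr scalerBl -[RHS](subrr 0) -{1}J -[in RHS](scaler0 _ (be * be)) -J'.
    rewrite [lbr (lbr _ _) _]lbrC scalerN opprK !scalerDr scalerN opprD.
    by rewrite addrACA subrr add0r.
  move/eqP: E; rewrite scaler_eq0 (negPf (br3_neq0 Ffree)) orbF mulf_eq0 (negPf be0).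
  by rewrite subr_eq0 => /eqP.
exists be => // M u v; rewrite -Hbr albe -scalerDr.
(* The missing fourth term [lp u, lp v] of the expansion is zero. *)
rewrite -{1}(lqpE u) -{1}(lqpE v) !(lbrDl _ (lp u)) !(lbrDr _ (lq v)).
by rewrite lbr_pp // addr0 addrA.
Qed.

(** A scalar taken out of [lq g0, lp g1] acts by a on the argument [lq g0] and by b on the bracket,
    which is fixed by [lp]; hence a = b. *)
Lemma s_scale_ex : forall a, exists b, forall M (u : F M), s (b *: u) = a *: s u.
Proof.
move=> x; have [c c0 Hbr] := s_br.
have [a [b Hx]] : exists a b, forall M (u : F M), s (a *: lq u + b *: lp u) = x *: s u.
  apply: (unary_word (phi := fun M t => x *: t)) => [M N h t hh|M t].
    by rewrite (homZ hh).
  by rewrite !scalerA mulrC.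
have ab : a = b.
  have := lbrZl x (s (lq g0)) (s (lp g1)).
  rewrite -Hx -!Hbr -Hx => /s_inj.
  rewrite lq_idem lp_lq scaler0 addr0 lbrZl lqZ lpZ lp_br_qp {2}/lq lp_br_qp subrr.
  rewrite !scaler0 add0r !scalerA mulrC => /eqP.
  rewrite -subr_eq0 -scalerBl scaler_eq0 (negPf (br_g_neq0 Ffree)) orbF -mulrBl mulf_eq0.
  by rewrite (negPf c0) orbF subr_eq0 => /eqP.
by exists a => M u; rewrite -Hx -ab -scalerDr lqpE.
Qed.

Hypothesis k_rigid : forall f : {rmorphism k -> k}, bijective f -> f =1 id.

(** The map [sg] with s (sg a . u) = a . s u is an automorphism of [k], hence the identity. *)
Lemma sZ M a (u : F M) : s (a *: u) = a *: s u.
Proof.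
have [sg sgE] := choice s_scale_ex.
have gx_inj a' b' : a' *: lq gx = b' *: lq gx -> a' = b'.
  move/eqP; rewrite -subr_eq0 -scalerBl scaler_eq0 (negPf (lq_gx_neq0 Ffree)) orbF.
  by rewrite subr_eq0 => /eqP.
have sgB (x y : k) : sg (x - y) = sg x - sg y.
  by apply/gx_inj/s_inj; rewrite sgE !scalerBl [RHS]sD sN !sgE.
have sg1 : sg 1 = 1 by apply/gx_inj/s_inj; rewrite sgE !scale1r.
have sgM (x y : k) : sg (x * y) = sg x * sg y.
  by apply/gx_inj/s_inj; rewrite -scalerA !sgE scalerA.
pose f : {rmorphism k -> k} := HB.pack_for {rmorphism k -> k} sg
  (GRing.isZmodMorphism.Build k k sg sgB) (GRing.isMonoidMorphism.Build k k sg (conj sg1 sgM)).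
(* The preimage under [e] of s (b . lq gx) is killed by [lp], so it is a multiple c . lq gx, and c
   is sent to b. *)
have f_surj b : exists c, f c = b.
  have [v ev] := e_surj (s (b *: lq gx)).
  have pv : lp v = 0.
    by apply: e_inj; rewrite (hom_p e_hom) ev (hom0 e_hom) -s_lp lpZ lp_lq scaler0 s0.
  have [c [g vE]] := free1_form k_char0 Ffree v; exists c; apply/gx_inj/s_inj.
  rewrite /= sgE -ev -[v]lqpE pv addr0 vE lqD lqZ lq_idem lq_pact addr0.
  by rewrite (homZ e_hom) (hom_q e_hom) e_gx s_lq.
have [f' f'K] := choice f_surj.
have f_bij : bijective f by exists f' => // c; apply: (fmorph_inj f); rewrite f'K.
by rewrite -sgE; congr (s (_ *: _)); exact/esym/(k_rigid f_bij).
Qed.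

(** The homothety absorbs the factor of the bracket: c c^-1 c^-1 = c^-1. *)
Lemma transport_hom : exists2 c, c != 0 & forall M, is_hom (fun u : F M => s (c *: u)).
Proof.
have [c c0 Hbr] := s_br; exists c^-1; first by rewrite invr_eq0.
move=> M; split=> [a x y|]; first by rewrite !sZ sD sZ scalerDr !scalerA mulrC.
split=> [x y|x]; last by rewrite -s_lp lpZ.
by rewrite -Hbr lbrZl lbrZr !scalerA ?mulrA mulfV // mul1r.
Qed.

End Transport.

Lemma hom_inverse (k : fieldType) (A B : LieP k) (h : A -> B) :
    is_hom h -> injective h -> (forall y, exists x, h x = y) ->
  exists t : B -> A, [/\ is_hom t, cancel h t & cancel t h].
Proof.
move=> hh hI /choice[t tK]; exists t; split=> [|x|//]; last exact/hI/tK.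
split=> [a x y|]; first by apply: hI; rewrite hh.1 !tK.
by split=> [x y|x]; apply: hI; rewrite ?(hom_br hh) ?(hom_p hh) !tK.
Qed.

(** * The image of F(1) under the automorphism, and the natural bijections *)

Section Automorphism.
Variables (k : fieldType) (F : {fset nat} -> LieP k) (iota : forall M, nat -> F M).
Hypotheses (k_char0 : [pchar k] =i pred0) (Ffree : free_family iota).
Variables (Uo : {fset nat} -> {fset nat})
  (Um : forall M N, ThHom (F M) (F N) -> ThHom (F (Uo M)) (F (Uo N))).
Hypothesis UmP : cat_automorphism Um.
Local Notation gx := (gx iota).
Local Notation ev1 := (ev1 Ffree).

Let Um_ext M N (f g : ThHom (F M) (F N)) : sval f =1 sval g -> sval (Um f) =1 sval (Um g).
Proof. by case: UmP => _ + _ _ _; apply. Qed.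

Let Um_id M (f : ThHom (F M) (F M)) : sval f =1 id -> sval (Um f) =1 id.
Proof. by case: UmP => _ _ + _ _; apply. Qed.

Let Um_comp M N P (f : ThHom (F M) (F N)) (g : ThHom (F N) (F P)) (h : ThHom (F M) (F P)) :
  sval h =1 sval g \o sval f -> sval (Um h) =1 sval (Um g) \o sval (Um f).
Proof. by case: UmP => _ _ _ + _; apply. Qed.

Let Um_inj M N (f g : ThHom (F M) (F N)) : sval (Um f) =1 sval (Um g) -> sval f =1 sval g.
Proof. by case: UmP => _ _ _ _ /(_ M N)[+ _]; apply. Qed.

Let Um_full M N (g : ThHom (F (Uo M)) (F (Uo N))) :
  exists f : ThHom (F M) (F N), sval (Um f) =1 sval g.
Proof. by case: UmP => _ _ _ _ /(_ M N)[_]; apply. Qed.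

Definition homc A B C (g : ThHom B C) (f : ThHom A B) : ThHom A C :=
  exist _ (sval g \o sval f) (@hom_comp k A B C _ _ (svalP g) (svalP f)).

(* One-sided invertible endomorphisms of F M1 are diagonal, hence commute;
   this carries over to the endomorphism monoid of its image. *)
Lemma end_image_comm (f f' g g' : ThHom (F (Uo M1)) (F (Uo M1))) :
    sval f \o sval f' =1 id -> sval g \o sval g' =1 id ->
  sval f \o sval g =1 sval g \o sval f.
Proof.
have [[f0 Ef] [f0' Ef']] := (Um_full f, Um_full f').
have [[h0 Eg] [h0' Eg']] := (Um_full g, Um_full g').
pose i1 : ThHom (F M1) (F M1) := exist _ id (hom_id _).
have back (a b a' b' : ThHom (F M1) (F M1)) (c d : ThHom (F (Uo M1)) (F (Uo M1))) :
    sval (Um a) =1 sval c -> sval (Um b) =1 sval d -> sval c \o sval d =1 id ->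
    sval a \o sval b =1 id.
  move=> ac bd cd; apply: (Um_inj (f := homc a b) (g := i1)) => u.
  rewrite (Um_comp (f := b) (g := a)) // (Um_id (f := i1)) //=.
  by rewrite ac bd; apply: cd.
have evE (a : ThHom (F M1) (F M1)) u : sval a u = ev1 (sval a gx) u.
  by apply: (hom_free1_eq Ffree) (svalP a) (ev1_hom Ffree _) _ u; rewrite ev1E.
have lin (a b : ThHom (F M1) (F M1)) : sval a \o sval b =1 id ->
    exists c d, sval a gx = c *: lq gx + d *: lp gx.
  move=> ab; apply: (right_inv_linear k_char0 (Ffree := Ffree) (v := sval b gx)).
  by rewrite -evE; apply: ab.
move=> /(back _ _ f0 f0' _ _ Ef Ef') /lin[c [d fE]].
move=> /(back _ _ h0 h0' _ _ Eg Eg') /lin[c' [d' gE]] u.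
have fg0 : sval (homc f0 h0) =1 sval (homc h0 f0).
  apply: (hom_free1_eq Ffree) (svalP _) (svalP _) _.
  rewrite [LHS](evE f0 (sval h0 gx)) [RHS](evE h0 (sval f0 gx)) fE gE.
  exact: linear_comm.
have := Um_ext fg0 u.
rewrite (Um_comp (f := h0) (g := f0) (h := homc f0 h0)) //.
rewrite (Um_comp (f := f0) (g := h0) (h := homc h0 f0)) //.
by rewrite /= Eg Ef Ef Eg.
Qed.

Lemma free_gen_neq0 (N : {fset nat}) n : n \in N -> iota N n <> 0.
Proof.
move=> nN E; have h := ext_hom Ffree N (fun => 1 : abLieP k true).
have := congr1 (ext Ffree N (fun => 1 : abLieP k true)) E.
by rewrite extE // (hom0 h) => /eqP; rewrite oner_eq0.
Qed.

(** With no generator the identity and zero endomorphisms of [F M1] would have equal images; with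
    two, a transposition and a dilation of one generator are invertible and do not commute. *)
Lemma image_singleton : exists2 n, n \in Uo M1 & forall i, i \in Uo M1 -> i = n.
Proof.
have [n nN] : exists n, n \in Uo M1.
  apply: contrapT => /forallNP N0.
  pose i1 : ThHom (F M1) (F M1) := exist _ id (hom_id _).
  pose z1 : ThHom (F M1) (F M1) := exist _ _ (hom_zero (F M1) (F M1)).
  apply: (free_gen_neq0 (N := M1) (n := 0%N)); first by rewrite !inE.
  apply: (Um_inj (f := i1) (g := z1)).
  by apply: (hom_free_eq Ffree (svalP _) (svalP _)) => i /N0.
exists n => // m mN; apply: contrapT => /eqP mn.
pose f i := iota (Uo M1) (if i == n then m else if i == m then n else i).
pose g i := if i == n then 2 *: iota (Uo M1) n else iota (Uo M1) i.
pose g' i := if i == n then 2^-1 *: iota (Uo M1) n else iota (Uo M1) i.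
pose H f := exist _ _ (ext_hom Ffree (Uo M1) f) : ThHom (F (Uo M1)) (F (Uo M1)).
have inM i : i \in Uo M1 -> (if i == n then m else if i == m then n else i) \in Uo M1.
  by case: eqP => // _; case: eqP.
have ff : sval (H f) \o sval (H f) =1 id.
  apply: (hom_free_eq Ffree (hom_comp (ext_hom _ _ _) (ext_hom _ _ _)) (hom_id _)) => i iM.
  rewrite /= extE // /f extE ?inM //; congr (iota _ _).
  case: (eqVneq i n) => [->|ni]; first by rewrite (negPf mn) eqxx.
  by case: (eqVneq i m) => [->|mi]; rewrite ?eqxx // (negPf ni) (negPf mi).
have gg : sval (H g) \o sval (H g') =1 id.
  apply: (hom_free_eq Ffree (hom_comp (ext_hom _ _ _) (ext_hom _ _ _)) (hom_id _)) => i iM.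
  have h := ext_hom Ffree (Uo M1) g.
  rewrite /= extE // /g'; case: eqVneq => [->|ni].
    by rewrite (homZ h) extE // /g eqxx scalerA mulVf ?scale1r // two_neq0.
  by rewrite extE // /g (negPf ni).
have := end_image_comm ff gg (iota _ n).
have h := ext_hom Ffree (Uo M1) f.
have fn : ext Ffree (Uo M1) f (iota _ n) = iota _ m by rewrite extE // /f eqxx.
have gn : ext Ffree (Uo M1) g (iota _ n) = 2 *: iota _ n by rewrite extE // /g eqxx.
have gm : ext Ffree (Uo M1) g (iota _ m) = iota _ m by rewrite extE // /g (negPf mn).
rewrite /= gn (homZ h) fn gm.
rewrite scaler_nat mulr2n -[RHS]addr0 => /addrI; exact: free_gen_neq0.
Qed.

Lemma image_iso : exists e : F M1 -> F (Uo M1),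
  [/\ is_hom e, injective e & forall t, exists u, e u = t].
Proof.
have [n nN nU] := image_singleton; pose e := ev1 (iota (Uo M1) n).
pose e' := ext Ffree (Uo M1) (fun => gx).
have he : is_hom e := ev1_hom Ffree _.
have he' : is_hom e' := ext_hom Ffree _ _.
exists e; split=> //.
  apply: (can_inj (g := e')); apply: (hom_free1_eq Ffree (hom_comp he' he) (hom_id _)).
  by rewrite /= /e ev1E /e' extE.
move=> t; exists (e' t); move: t.
apply: (hom_free_eq Ffree (hom_comp he he') (hom_id _)) => i iN.
by rewrite /= /e' extE // /e ev1E (nU i).
Qed.

(** An element u of F M is a homomorphism F(1) -> F M; [s] evaluates its image at the generator
    [e gx]. Faithfulness gives injectivity, fullness surjectivity, and composition naturality. *)
Lemma natural_bijection : exists (s : forall M, F M -> F (Uo M)) (e : F M1 -> F (Uo M1)),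
  [/\ forall M, injective (@s M), forall M t, exists u, s M u = t,
      forall M N (h : ThHom (F M) (F N)) u, sval (Um h) (s M u) = s N (sval h u) &
      [/\ is_hom e, injective e, (forall t, exists u, e u = t) & e gx = s M1 gx]].
Proof.
have [e [he eI eS]] := image_iso; have [e' [he' eK e'K]] := hom_inverse he eI eS.
pose E M (u : F M) : ThHom (F M1) (F M) := exist _ _ (ev1_hom Ffree u).
exists (fun M u => sval (Um (E M u)) (e gx)), e; split=> [M u v /= uv|M t|M N h u|].
- have Uuv : sval (Um (E M u)) =1 sval (Um (E M v)).
    move=> t; rewrite -(e'K t); move: (e' t).
    exact: (hom_free1_eq Ffree (hom_comp (svalP _) he) (hom_comp (svalP _) he)).
  by have := Um_inj Uuv gx; rewrite /= !ev1E.
- pose g : ThHom (F (Uo M1)) (F (Uo M)) :=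
    exist _ _ (hom_comp (ev1_hom Ffree t) he').
  have [f fg] := Um_full g; exists (sval f gx).
  rewrite (Um_ext (g := f)) ?fg /= ?eK ?ev1E // => v.
  by apply: (hom_free1_eq Ffree (ev1_hom _ _) (svalP _)); rewrite /= ev1E.
- rewrite [RHS](Um_comp (f := E M u) (g := h)) // => v.
  apply: (hom_free1_eq Ffree (svalP _) (hom_comp (svalP _) (svalP _))).
  by rewrite /= !ev1E.
- split=> //; rewrite (Um_id (f := E M1 gx)) // => v.
  by apply: (hom_free1_eq Ffree (svalP _) (hom_id _)); rewrite /= ev1E.
Qed.

End Automorphism.

(** * The natural isomorphism from the identity functor to [Um] *)

Theorem theorem7 (k : fieldType)
  (k_infinite : ~ (exists s : seq k, forall x : k, x \in s))
  (k_char0 : [pchar k] =i pred0)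
  (k_rigid : forall f : {rmorphism k -> k}, bijective f -> f =1 id)
  (F : {fset nat} -> LieP k) (iota : forall M, nat -> F M)
  (Ffree : free_family iota)
  (Uo : {fset nat} -> {fset nat})
  (Um : forall M N, ThHom (F M) (F N) -> ThHom (F (Uo M)) (F (Uo N))) :
  cat_automorphism Um -> inner_automorphism Um.
Proof.
move=> UmP; have [s [e [sI sS sN [he eI eS eE]]]] := natural_bijection k_char0 Ffree UmP.
have s_nat M N (h : F M -> F N) : is_hom h ->
    exists2 h' : F (Uo M) -> F (Uo N), is_hom h' & forall u, h' (s M u) = s N (h u).
  move=> hh; pose H : ThHom (F M) (F N) := exist _ h hh.
  by exists (sval (Um M N H)); [apply: svalP | move=> u; rewrite sN].
have [c c0 shom] := transport_hom k_char0 Ffree sI sS s_nat he eI eS eE k_rigid.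
(* Naturality survives the correction because homomorphisms commute with homotheties. *)
exists (fun M => exist _ _ (shom M)); split=> [M|M N h u].
  have [|t|t [ht tK Kt]] := hom_inverse (shom M).
  - by move=> u v /sI /(scalerI c0).
  - by have [u <-] := sS M t; exists (c^-1 *: u); rewrite scalerA divff ?scale1r.
  - by exists (exist _ t ht).
by rewrite /= sN (homZ (svalP h)).
Qed.
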